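(* Let $N$ be an $m\times n$ matrix with $m,n\ge 3$ which is a (totally unimodular) compact representation matrix of a $3$-connected regular matroid. If $N$ contains, up to row and column permutations and scaling of rows and columns by $-1$, the submatrix $\begin{bmatrix}1&1\\1&1\end{bmatrix}$, then $N$ is not strongly unimodular.
   Context: A real matrix is totally unimodular (TU) if every square submatrix has determinant $0$, $+1$ or $-1$. A matrix $A$ is strongly unimodular (SU) if (i) $A$ is TU, and (ii) every matrix obtained from $A$ by setting a single $\pm1$ entry to $0$ is also TU. A compact representation matrix of a matroid $M$ over $\mathbb R$ is a matrix $A$ with $m$ rows such that $M$ is the column matroid of $[I_m\,|\,A]$. *)

(* Defs.v *)
From HB Require Import structures.
From mathcomp Require Import all_boot all_order all_algebra.
Set Implicit Arguments. Unset Strict Implicit. Unset Printing Implicit Defensive.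
Import Order.TTheory GRing.Theory Num.Theory.
Local Open Scope ring_scope.

Definition TU (R : realFieldType) (m n : nat) (A : 'M[R]_(m, n)) : Prop :=
  forall (k : nat) (f : 'I_k -> 'I_m) (g : 'I_k -> 'I_n),
    injective f -> injective g ->
    let d := \det (mxsub f g A) in d = 0 \/ d = 1 \/ d = -1.

Definition zero_entry (R : realFieldType) (m n : nat) (A : 'M[R]_(m, n))
  (i : 'I_m) (j : 'I_n) : 'M[R]_(m, n) :=
  \matrix_(a, b) if (a == i) && (b == j) then 0 else A a b.

Definition SU (R : realFieldType) (m n : nat) (A : 'M[R]_(m, n)) : Prop :=
  TU A /\ forall i j, (A i j = 1 \/ A i j = -1) -> TU (zero_entry A i j).

(* Rank function of the column matroid of A (ground set = column indices). *)
Definition cm_rank (R : realFieldType) (m n : nat) (A : 'M[R]_(m, n))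
  (X : {set 'I_n}) : nat :=
  \rank (colsub (fun k : 'I_#|X| => enum_val k) A).

(* (X, complement of X) is a k-separation of the column matroid of A:
   |X|, |Y| >= k and r(X) + r(Y) - r(E) <= k - 1. *)
Definition k_separation (R : realFieldType) (m n : nat) (A : 'M[R]_(m, n))
  (k : nat) (X : {set 'I_n}) : Prop :=
  (k <= #|X|)%N /\ (k <= #|~: X|)%N /\
  (cm_rank A X + cm_rank A (~: X) < cm_rank A setT + k)%N.

Definition three_connected (R : realFieldType) (m n : nat) (A : 'M[R]_(m, n))
  : Prop :=
  forall (k : nat) (X : {set 'I_n}), (1 <= k < 3)%N -> ~ k_separation A k X.

(* Compact representation: the matroid is the column matroid of [I_m | A]. *)
Definition compact_rep (R : realFieldType) (m n : nat) (A : 'M[R]_(m, n))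
  : 'M[R]_(m, m + n) := row_mx 1%:M A.

Definition is_sign (R : realFieldType) (s : R) : Prop := s = 1 \/ s = -1.

Definition has_ones_2x2 (R : realFieldType) (m n : nat) (A : 'M[R]_(m, n))
  : Prop :=
  exists (i1 i2 : 'I_m) (j1 j2 : 'I_n) (s1 s2 t1 t2 : R),
    [/\ i1 != i2, j1 != j2, is_sign s1 /\ is_sign s2, is_sign t1 /\ is_sign t2 &
     [/\ s1 * A i1 j1 * t1 = 1, s1 * A i1 j2 * t2 = 1,
         s2 * A i2 j1 * t1 = 1 & s2 * A i2 j2 * t2 = 1]].

(* Main.v *)
Require Import Defs.
From HB Require Import structures.
From mathcomp Require Import all_boot all_order all_algebra.
From mathcomp Require Import ring lra zify.
Set Implicit Arguments. Unset Strict Implicit. Unset Printing Implicit Defensive.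
Import Order.TTheory GRing.Theory Num.Theory.
Local Open Scope ring_scope.

(** View the support of [N] as a bipartite graph on rows and columns, and let
    [P x Q] be a maximal biclique with at least two rows and two columns.  Total
    unimodularity makes that block of rank 1, so if no path from [P] to [Q]
    avoided its edges there would be a 2-separation.  Take a shortest such path
    [r 0, c 0, r 1, c 1, ..., r K, c K].  Maximality provides [p'] in [P] and
    [q'] in [Q] with [N p' (c 0) = 0] and [N (r K) q' = 0].  In the submatrix on
    rows [p', r 0, ..., r K] and columns [q', c 0, ..., c K], the determinant is
    a unit [y], and zeroing the entry [(p', c K)] or [(r 0, c K)] turns it into
    [y + z], respectively [y - z], with [z] nonzero: these cannot both lie in
    [{0, 1, -1}]. *)

(** * Determinants after zeroing entries *)

Lemma det_zero_entry (R : realFieldType) n (B : 'M[R]_n) i j :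
  \det (zero_entry B i j) = \det B - B i j * cofactor B i j.
Proof.
have cofE k : cofactor (zero_entry B i j) k j = cofactor B k j.
  rewrite /cofactor; congr (_ * \det _).
  by apply/matrixP=> a b; rewrite !mxE (eq_sym _ j) (negPf (neq_lift _ _)) andbF.
rewrite (expand_det_col _ j) (expand_det_col B j) [in RHS](bigD1 i) //=.
rewrite (bigD1 i) //= !mxE !eqxx mul0r add0r addrC addrK.
by apply: eq_bigr => k /negPf ki; rewrite !mxE ki cofE.
Qed.

Lemma mxsub_zero_entry (R : realFieldType) m n p q (A : 'M[R]_(m, n))
    (f : 'I_p -> 'I_m) (g : 'I_q -> 'I_n) i j :
  injective f -> injective g ->
  mxsub f g (zero_entry A (f i) (g j)) = zero_entry (mxsub f g A) i j.
Proof.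
by move=> fI gI; apply/matrixP=> a b; rewrite !mxE !(inj_eq fI, inj_eq gI).
Qed.

Lemma det_trig_neq0 (R : realFieldType) n (B : 'M[R]_n) :
  is_trig_mx B -> (forall i, B i i != 0) -> \det B != 0.
Proof. by move=> /det_trig-> nz; apply/prodf_neq0 => i _. Qed.

Definition unimodular_value (R : realFieldType) (x : R) : Prop :=
  x = 0 \/ x = 1 \/ x = -1.

(* Zeroing either of the entries [(0, l)], [(1, l)] shifts the determinant by
   opposite nonzero amounts, so one of the two results has absolute value 2. *)
Lemma det_zero_entries_not_unimodular (R : realFieldType) k (B : 'M[R]_(k.+3))
    (i0 := ord0 : 'I_k.+3) (i1 := lift ord0 ord0 : 'I_k.+3)
    (l := ord_max : 'I_k.+3) :
  (forall i, B i i != 0) ->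
  (forall i j : 'I_k.+3, (i < j)%N -> B i j != 0 -> j = l /\ (i < 2)%N) ->
  (forall i : 'I_k.+3, (1 < i)%N -> B i i0 = 0) ->
  (forall i j : 'I_k.+3, (0 < j)%N -> (j.+1 < i)%N -> B i j = 0) ->
  (forall i j : 'I_k.+3, (0 < j)%N -> i = j.+1 :> nat -> B i j != 0) ->
  B i0 i0 * B i1 l = B i1 i0 * B i0 l ->
  B i0 l != 0 -> B i1 l != 0 ->
  unimodular_value (\det B) ->
  unimodular_value (\det (zero_entry B i0 l)) ->
  unimodular_value (\det (zero_entry B i1 l)) -> False.
Proof.
move=> Bd Bup B0 Blow Bsub minor0 nz0 nz1.
have i01 : i1 != i0 by [].
(* This is the [(l, i0)] entry of [\adj B *m B], hence 0; column [i0] vanishes below its first two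
   rows, so only two terms remain. *)
have orth : B i0 i0 * cofactor B i0 l + B i1 i0 * cofactor B i1 l = 0.
  have /matrixP/(_ l i0) := mul_adj_mx B.
  rewrite !mxE mulr0n => <-; rewrite (bigD1 i0) // (bigD1 i1) //= big1 => [|i].
    by rewrite !mxE addr0 mulrC [X in _ + X]mulrC.
  case/andP=> n0 n1; rewrite B0 ?mulr0 //.
  by case: i n0 n1 => [[|[|i]] Hi].
(* The vanishing minor on rows [i0], [i1] and columns [i0], [l] carries [orth] over from column [i0]
   to column [l]. *)
have opp : B i0 l * cofactor B i0 l = - (B i1 l * cofactor B i1 l).
  apply: (mulfI (Bd i0)); move/eqP: orth; rewrite addr_eq0 => /eqP orth.
  by rewrite mulrN [in RHS]mulrA minor0 mulrCA orth; ring.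
(* Deleting row [i1] and column [l] leaves an upper triangular matrix whose diagonal is [B i0 i0]
   followed by subdiagonal entries of [B]. *)
have cof1 : cofactor B i1 l != 0.
  rewrite /cofactor mulf_neq0 ?signr_eq0 // -det_tr det_trig_neq0 //.
    apply/is_trig_mxP => i j ij; rewrite !mxE.
    case: (posnP i) => [i_eq0|i_gt0].
      rewrite (_ : lift l i = i0); last by apply/val_inj; rewrite /= /bump i_eq0.
      rewrite B0 //= /bump /=; move: (leq_ltn_trans (leq0n i) ij).
      by case: (nat_of_ord j).
    have -> : lift i1 j = lift ord0 j.
      by apply/val_inj; rewrite /= /bump /= (leq_trans i_gt0 (ltnW ij)).
    by apply: Blow; rewrite /= /bump /= [(k.+2 <= i)%N]leqNgt ltn_ord.
  move=> i; rewrite !mxE; case: (posnP i) => [i_eq0|i_gt0].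
    have -> : lift i1 i = i0 by apply/val_inj; rewrite /= /bump i_eq0.
    have -> : lift l i = i0 by apply/val_inj; rewrite /= /bump i_eq0.
    exact: Bd.
  apply: Bsub; rewrite /= /bump /= [(k.+2 <= i)%N]leqNgt ltn_ord //=.
  by rewrite i_gt0.
(* By [opp], zeroing both entries leaves the determinant unchanged, and the result is lower
   triangular with the diagonal of [B]. *)
have det0 : \det B != 0.
  have cofE : cofactor (zero_entry B i0 l) i1 l = cofactor B i1 l.
    rewrite /cofactor; congr (_ * \det _); apply/matrixP=> a b.
    by rewrite !mxE (eq_sym _ l) (negPf (neq_lift _ _)) andbF.
  have -> : \det B = \det (zero_entry (zero_entry B i0 l) i1 l).
    rewrite !det_zero_entry cofE opp mxE (negPf i01) /=; lra.
  apply: det_trig_neq0 => [|i].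
    apply/is_trig_mxP=> i j ij; rewrite !mxE.
    case: (eqVneq (B i j) 0) => [->|nz]; first by rewrite !if_same.
    have [-> i2] := Bup i j ij nz; rewrite eqxx !andbT.
    by case: i i2 {ij nz} => [[|[|i]] Hi].
  rewrite !mxE; case: andP => [[/eqP-> /eqP//]|_].
  by case: andP => [[/eqP-> /eqP//]|_].
have : B i1 l * cofactor B i1 l != 0 by rewrite mulf_neq0.
rewrite !det_zero_entry opp /unimodular_value => z.
by case=> [|[]] dE; rewrite dE ?eqxx in det0 *;
  case=> [|[]] h1 [|[]] h2; apply/negP: z; rewrite negbK; apply/eqP; lra.
Qed.

(** * Small minors of totally unimodular matrices *)

Lemma TU_entry (R : realFieldType) m n (N : 'M[R]_(m, n)) i j :
  TU N -> N i j != 0 -> N i j = 1 \/ N i j = -1.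
Proof.
move=> tu; have inj1 p (x : 'I_p) : injective (fun _ : 'I_1 => x).
  by move=> a b _; rewrite !ord1.
have := tu 1%N (fun=> i) (fun=> j) (inj1 _ _) (inj1 _ _).
by rewrite /= det_mx11 mxE => -[->|//]; rewrite eqxx.
Qed.

(** With all four entries [1] or [-1] the minor is even, so total unimodularity forces it to be 0.
    Equal indices are allowed, so that [biclique_rank1] need not set the pivot row and column
    apart. *)
Lemma TU_minor2 (R : realFieldType) m n (N : 'M[R]_(m, n)) i i' j j' :
  TU N -> N i j != 0 -> N i j' != 0 -> N i' j != 0 -> N i' j' != 0 ->
  N i j * N i' j' = N i' j * N i j'.
Proof.
move=> tu; case: (eqVneq i i') => [->|ni]; first by rewrite mulrC.
case: (eqVneq j j') => [->|nj]; first by rewrite mulrC.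
have inj2 p (x y : 'I_p) : x != y ->
    injective (fun a : 'I_2 => if a == 0 then x else y).
  move=> xy a b; case: (eqVneq a 0) => [->|a0]; case: (eqVneq b 0) => [->|b0] //.
  - by move=> E; rewrite E eqxx in xy.
  - by move=> E; rewrite E eqxx in xy.
  by case: a b a0 b0 => [[|[|a]] Ha] [[|[|b]] Hb] // _ _ _; apply: val_inj.
have := tu 2%N _ _ (inj2 _ _ _ ni) (inj2 _ _ _ nj).
rewrite /= (expand_det_row _ 0) !big_ord_recl big_ord0 addr0.
rewrite /cofactor !det_mx11 !mxE /=.
move=> d /TU_entry - /(_ tu) a /TU_entry - /(_ tu) b.
move=> /TU_entry - /(_ tu) c /TU_entry - /(_ tu) e.
by move: a b c e d => [->|->] [->|->] [->|->] [->|->]; lra.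
Qed.

(** * Rank bounds and 2-separations *)

Lemma rank_row_support (R : fieldType) m n (M : 'M[R]_(m, n)) (S : {set 'I_m}) :
  (forall i j, i \notin S -> M i j = 0) -> (\rank M <= #|S|)%N.
Proof.
move=> M0; pose T : 'M[R]_(m, #|S|) := \matrix_(i, k) (i == enum_val k)%:R.
have -> : M = T *m rowsub (fun k : 'I_#|S| => enum_val k) M.
  apply/matrixP=> i j; rewrite !mxE.
  case: (boolP (i \in S)) => [iS|iS].
    rewrite (bigD1 (enum_rank_in iS i)) //= !mxE enum_rankK_in // eqxx mul1r.
    rewrite big1 ?addr0 // => k nk; rewrite !mxE.
    case: eqP => [E|_]; last by rewrite mul0r.
    by move/eqP: nk; case; apply: enum_val_inj; rewrite enum_rankK_in.
  rewrite M0 // big1 // => k _; rewrite !mxE; case: eqP => [E|_]; last by rewrite mul0r.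
  by rewrite E enum_valP in iS.
exact: leq_trans (mxrankM_maxl _ _) (rank_leq_col _).
Qed.

(* A partition of the rows and columns whose two off-diagonal blocks have rank
   at most 1 and 0 is a 2-separation of the column matroid of [I | N]. *)
Lemma two_separation_of_blocks (R : realFieldType) m n (N : 'M[R]_(m, n))
    (R1 : {set 'I_m}) (C1 : {set 'I_n}) (u : 'I_m -> R) (v : 'I_n -> R) :
  (1 < #|R1|)%N -> (1 < #|~: C1|)%N ->
  (forall i j, i \notin R1 -> j \in C1 -> N i j = 0) ->
  (forall i j, i \in R1 -> j \notin C1 -> N i j = u i * v j) ->
  exists X, k_separation (compact_rep N) 2 X.
Proof.
move=> R1gt C1gt N21 N12.
pose X := [set k | match split k with inl i => i \in R1 | inr j => j \in C1 end].
have XL i : (lshift n i \in X) = (i \in R1) by rewrite inE (unsplitK (inl _ i)).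
have XR j : (rshift m j \in X) = (j \in C1) by rewrite inE (unsplitK (inr _ j)).
exists X; split; [|split].
- apply: leq_trans R1gt _; rewrite -(card_imset _ (@lshift_inj m n)).
  by apply/subset_leq_card/subsetP=> _ /imsetP[i iR ->]; rewrite XL.
- apply: leq_trans C1gt _; rewrite -(card_imset _ (@rshift_inj m n)).
  apply/subset_leq_card/subsetP=> _ /imsetP[j jC ->].
  by rewrite inE XR -in_setC.
have rX : (cm_rank (compact_rep N) X <= #|R1|)%N.
  apply: rank_row_support => i k iR; rewrite mxE; move: (enum_valP k).
  case: (split_ordP (enum_val k)) => j ->; rewrite ?XL ?XR => jX.
    by rewrite row_mxEl mxE; case: eqP => // E; rewrite E jX in iR.
  by rewrite row_mxEr N21.
have rY : (cm_rank (compact_rep N) (~: X) <= #|~: R1| + 1)%N.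
  rewrite /cm_rank; set M := colsub _ _.
  (* Subtracting [a *m b] clears the rows in [R1]: identity columns outside [X] are already zero
     there, and the columns of [N] outside [X] equal [u i * v j]. *)
  pose a : 'cV[R]_m := \col_i (if i \in R1 then u i else 0).
  pose b : 'rV[R]_#|~: X| :=
    \row_k (if split (enum_val k) is inr j then v j else 0).
  rewrite -[M](subrK (a *m b)); apply: leq_trans (mxrank_add _ _) _.
  apply: leq_add; last exact: leq_trans (mxrankM_maxl _ _) (rank_leq_col _).
  apply: rank_row_support => i k; rewrite inE negbK => iR.
  rewrite !mxE big_ord1 !mxE iR; move: (enum_valP k); rewrite inE.
  case: (split_ordP (enum_val k)) => j ->; rewrite ?XL ?XR => jX.
    rewrite mxE mulr0 subr0.
    by case: eqP => // E; rewrite -E iR in jX.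
  by rewrite N12 ?subrr.
have rT : (m <= cm_rank (compact_rep N) setT)%N.
  rewrite /cm_rank -[X in (X <= _)%N](mxrank1 R).
  have -> : 1%:M = colsub (fun k : 'I_#|[set: 'I_(m + n)]| => enum_val k)
     (compact_rep N) *m \matrix_(k, j) (enum_val k == lshift n j)%:R :> 'M[R]_m.
    apply/matrixP=> i j; rewrite [RHS]mxE.
    rewrite (bigD1 (enum_rank_in (in_setT (lshift n j)) (lshift n j))) //=.
    rewrite [in RHS]mxE [X in _ * X]mxE enum_rankK_in // eqxx mulr1 /compact_rep row_mxEl.
    rewrite big1 ?addr0 // => k nk.
    rewrite !mxE; case: eqP => [E|_]; last by rewrite mulr0.
    by rewrite -E enum_valK_in eqxx in nk.
  exact: mxrankM_maxl.
(* The two ranks add up to at most [m + 1], one less than the bound [m + 2] to beat. *)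
apply: leq_ltn_trans (leq_add rX rY) _.
by rewrite addnA cardsC card_ord addn2 addn1 !ltnS.
Qed.

(** * Shortest paths in a bipartite graph *)

Section BipartitePaths.
Variables (S T : finType) (e : S -> T -> bool) (P : {set S}) (Q : {set T}).

Definition right_nbhd (X : {set S}) : {set T} := [set c | [exists r in X, e r c]].
Definition left_nbhd (Y : {set T}) : {set S} := [set r | [exists c in Y, e r c]].

(** Levels hold the ends of walks of an exact length that may backtrack, so they can overlap;
    distances enter only through the minimal [K] chosen later. *)
Definition left_level k : {set S} := iter k (left_nbhd \o right_nbhd) P.
Definition right_level k : {set T} := right_nbhd (left_level k).

Lemma right_levelP k c :
  reflect (exists2 r, r \in left_level k & e r c) (c \in right_level k).
Proof.
by rewrite inE; apply: (iffP exists_inP) => -[r]; exists r.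
Qed.

Lemma left_levelSP k r :
  reflect (exists2 c, c \in right_level k & e r c) (r \in left_level k.+1).
Proof.
by rewrite inE; apply: (iffP exists_inP) => -[c]; exists c.
Qed.

Definition left_reach : {set S} :=
  [set r | [exists p in P, connect [rel a b | [exists c, e a c && e b c]] p r]].

Lemma left_reach_level r : r \in left_reach -> exists k, r \in left_level k.
Proof.
rewrite inE => /exists_inP[p pP /connectP[s]].
elim/last_ind: s r => [|s r' IHs] r /=; first by move=> _ ->; exists 0%N.
rewrite rcons_path last_rcons => /andP[ps /existsP[c /andP[e1 e2]]] ->.
have [k rk] := IHs _ ps erefl.
by exists k.+1; apply/left_levelSP; exists c => //; apply/right_levelP; exists (last p s).
Qed.

Lemma left_reach_step r r' c : r \in left_reach -> e r c -> e r' c -> r' \in left_reach.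
Proof.
rewrite !inE => /exists_inP[p pP pr] rc r'c; apply/exists_inP; exists p => //.
by apply: connect_trans pr (connect1 _); apply/existsP; exists c; rewrite rc.
Qed.

Lemma walk_of_level k c : c \in right_level k ->
  exists (r : nat -> S) (d : nat -> T),
    [/\ r 0%N \in P, d k = c, forall i, (i <= k)%N -> e (r i) (d i)
      & forall i, (i < k)%N -> e (r i.+1) (d i)].
Proof.
elim: k c => [|k IHk] c /right_levelP[r rk rc].
  by exists (fun=> r), (fun=> c).
have [c' /IHk[r0 [d [r0P dk rd rd']]] rc'] := left_levelSP _ _ rk.
exists (fun i => if (i <= k)%N then r0 i else r).
exists (fun i => if (i <= k)%N then d i else c); split=> //; first by rewrite ltnn.
  by move=> i ik; case: leqP => // ki; apply: rd.
move=> i ik; rewrite -[(i <= k)%N]ltnS ik; case: ltnP => [ki|ki]; first exact: rd'.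
have -> : i = k by lia.
by rewrite dk.
Qed.

(** The remainder of the walk is appended to any other route to [d j]. Applied to a shortcut, this
    contradicts the minimality of the walk's length. *)
Lemma level_of_walk k (r : nat -> S) (d : nat -> T) :
  (forall i, (i <= k)%N -> e (r i) (d i)) ->
  (forall i, (i < k)%N -> e (r i.+1) (d i)) ->
  forall i j, (j <= k)%N -> d j \in right_level i -> d k \in right_level (i + (k - j)).
Proof.
move=> rd rd' i j jk dj; rewrite -{1}(subnKC jk).
have : (j + (k - j) <= k)%N by rewrite subnKC.
elim: (k - j)%N => [|t IHt] jt; first by rewrite !addn0.
rewrite !addnS; apply/right_levelP; exists (r (j + t).+1); last by apply: rd; lia.
by apply/left_levelSP; exists (d (j + t)%N); [apply: IHt; lia | apply: rd'; lia].
Qed.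

(** If nothing reachable from [P] meets [Q], the reachable vertices are closed under edges and
    separate. Otherwise, on a walk to the first level meeting [Q], a chord or a premature contact
    with [P] or [Q] would give a shorter walk. *)
Lemma separated_or_shortest_path :
  (exists (R1 : {set S}) (C1 : {set T}),
     [/\ P \subset R1, [disjoint C1 & Q]
       & forall r c, e r c -> (r \in R1) = (c \in C1)])
  \/
  (exists K (r : nat -> S) (c : nat -> T),
     [/\ r 0%N \in P, c K \in Q, forall i, (i <= K)%N -> e (r i) (c i)
       & forall i, (i < K)%N -> e (r i.+1) (c i)] /\
     [/\ forall i j, (i <= K)%N -> (j <= K)%N -> e (r i) (c j) -> (j <= i <= j.+1)%N,
         forall j p, (j <= K)%N -> p \in P -> e p (c j) -> j = 0%N,
         forall i q, (i <= K)%N -> q \in Q -> e (r i) q -> i = K,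
         forall i, (i <= K)%N -> r i \in P -> i = 0%N
       & forall j, (j <= K)%N -> c j \in Q -> j = K]).
Proof.
case: (boolP [disjoint right_nbhd left_reach & Q]) => [dis|].
  left; exists left_reach, (right_nbhd left_reach); split=> // [|r c rc].
    by apply/subsetP=> p pP; rewrite inE; apply/exists_inP; exists p.
  apply/idP/idP => [rR|]; first by rewrite inE; apply/exists_inP; exists r.
  by rewrite inE => /exists_inP[r' r'R r'c]; exact: left_reach_step r'R r'c rc.
case/pred0Pn=> q /andP[/= ]; rewrite inE.
move=> /exists_inP[r0 /left_reach_level[k0 r0k] r0q] qQ.
have ex_k : exists k, [exists q in Q, q \in right_level k].
  by exists k0; apply/exists_inP; exists q => //; apply/right_levelP; exists r0.
case: (ex_minnP ex_k) => K /exists_inP[c0 c0Q /walk_of_level[r [c [r0P cK rc rc']]]] Kmin.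
right; exists K, r, c; rewrite cK.
have cQ k d : d \in Q -> d \in right_level k -> (K <= k)%N.
  by move=> dQ dk; apply: Kmin; apply/exists_inP; exists d.
(* Reaching [c j] at level [i] puts [c K] in level [i + (K - j)], which must be at least [K]. *)
have c_level i j : (j <= K)%N -> c j \in right_level i -> (j <= i)%N.
  move=> jK /(level_of_walk rc rc' jK) /cQ; rewrite cK => /(_ c0Q); lia.
have r_level i j : (j <= K)%N -> r j \in left_level i -> (j <= i)%N.
  by move=> jK rj; apply: c_level => //; apply/right_levelP; exists (r j); last exact: rc.
have r_in i : (i <= K)%N -> r i \in left_level i.
  elim: i => [//|i IHi] iK; apply/left_levelSP; exists (c i); last exact: rc'.
  by apply/right_levelP; exists (r i); [apply: IHi; lia|apply: rc; lia].
have c_in i : (i <= K)%N -> c i \in right_level i.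
  by move=> iK; apply/right_levelP; exists (r i); [apply: r_in | apply: rc].
split; split=> //.
- move=> i j iK jK ij; apply/andP; split.
    by apply: c_level => //; apply/right_levelP; exists (r i) => //; apply: r_in.
  by apply: r_level => //; apply/left_levelSP; exists (c j) => //; apply: c_in.
- move=> j p jK pP pc; apply/eqP; rewrite -leqn0; apply: c_level => //.
  by apply/right_levelP; exists p.
- move=> i q' iK q'Q rq; apply/eqP; rewrite eqn_leq iK; apply: (cQ _ q') => //.
  by apply/right_levelP; exists (r i) => //; apply: r_in.
- by move=> i iK iP; apply/eqP; rewrite -leqn0; apply: r_level.
- by move=> j jK jQ; apply/eqP; rewrite eqn_leq jK; apply: cQ jQ (c_in _ jK).
Qed.

End BipartitePaths.

(** * Maximal bicliques in the support *)

Definition biclique (R : realFieldType) m n (N : 'M[R]_(m, n))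
    (P : {set 'I_m}) (Q : {set 'I_n}) : bool :=
  [forall r in P, forall c in Q, N r c != 0].

Lemma bicliqueP (R : realFieldType) m n (N : 'M[R]_(m, n))
    (P : {set 'I_m}) (Q : {set 'I_n}) :
  reflect (forall r c, r \in P -> c \in Q -> N r c != 0) (biclique N P Q).
Proof.
apply: (iffP forall_inP) => [h r c rP cQ|h r rP].
  by move/forall_inP: (h r rP); apply.
by apply/forall_inP=> c cQ; apply: h.
Qed.

(** Among bicliques with at least two rows and two columns, one maximizing [#|P| + #|Q|] is taken; a
    further row or column without a zero could be added to it. *)
Lemma maximal_biclique (R : realFieldType) m n (N : 'M[R]_(m, n)) :
  has_ones_2x2 N ->
  exists (P : {set 'I_m}) (Q : {set 'I_n}),
    [/\ (1 < #|P|)%N, (1 < #|Q|)%N, biclique N P Q,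
        forall r, r \notin P -> exists2 c, c \in Q & N r c = 0
      & forall c, c \notin Q -> exists2 r, r \in P & N r c = 0].
Proof.
case=> i1 [i2 [j1 [j2 [s1 [s2 [t1 [t2]]]]]]] [i12 j12 _ _ [E11 E12 E21 E22]].
have nz (s x t : R) : s * x * t = 1 -> x != 0.
  move=> E; apply/eqP=> x0; move: E; rewrite x0 mulr0 mul0r => /eqP.
  by rewrite eq_sym oner_eq0.
pose ok (X : {set 'I_m} * {set 'I_n}) :=
  [&& (1 < #|X.1|)%N, (1 < #|X.2|)%N & biclique N X.1 X.2].
have ok0 : ok ([set i1; i2], [set j1; j2]).
  rewrite /ok /= !cards2 i12 j12 /=; apply/bicliqueP=> r c.
  by rewrite !inE => /orP[]/eqP-> /orP[]/eqP->; apply: nz; eassumption.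
case: (arg_maxnP (fun X : {set 'I_m} * {set 'I_n} => #|X.1| + #|X.2|)%N ok0).
move=> [P Q] /and3P[/= P2 Q2 bPQ] maxPQ; exists P, Q; split=> // [r rP|c cQ].
  suff /exists_inP[c cQ /eqP rc] : [exists c in Q, N r c == 0] by exists c.
  apply/negbNE/negP; rewrite negb_exists_in => /forall_inP h.
  have /maxPQ : ok (r |: P, Q).
    rewrite /ok /= Q2 cardsU1 rP /= (leq_trans P2) ?leq_addl //=.
    apply/bicliqueP=> r' c; rewrite in_setU1 => /orP[/eqP->|]; first exact: h.
    exact: (bicliqueP _ _ _ bPQ).
  by rewrite /= cardsU1 rP -addnA add1n ltnn.
suff /exists_inP[r rP /eqP rc] : [exists r in P, N r c == 0] by exists r.
apply/negbNE/negP; rewrite negb_exists_in => /forall_inP h.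
have /maxPQ : ok (P, c |: Q).
  rewrite /ok /= P2 cardsU1 cQ /= (leq_trans Q2) ?leq_addl //=.
  apply/bicliqueP=> r c' rP; rewrite in_setU1 => /orP[/eqP->|]; first exact: h.
  exact: (bicliqueP _ _ _ bPQ).
by rewrite /= cardsU1 cQ addnCA add1n ltnn.
Qed.

Lemma biclique_rank1 (R : realFieldType) m n (N : 'M[R]_(m, n))
    (P : {set 'I_m}) (Q : {set 'I_n}) p0 q0 r c :
  TU N -> biclique N P Q -> p0 \in P -> q0 \in Q -> r \in P -> c \in Q ->
  N r c = N r q0 * (N p0 c / N p0 q0).
Proof.
move=> tu /bicliqueP nz p0P q0Q rP cQ.
by rewrite mulrA (TU_minor2 (i := r) tu) ?nz // [_ * N r c]mulrC mulfK ?nz.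
Qed.

(** * The separation and the path submatrix *)

Theorem mainTheorem10 (R : realFieldType) (m n : nat) (N : 'M[R]_(m, n)) :
  (3 <= m)%N -> (3 <= n)%N ->
  TU N ->
  three_connected (compact_rep N) ->
  has_ones_2x2 N ->
  ~ SU N.
Proof.
move=> _ _ tu conn /maximal_biclique[P [Q [P2 Q2 bPQ maxP maxQ]]] [_ su].
have nzPQ := bicliqueP _ _ _ bPQ.
pose e r c := (N r c != 0) && ~~ ((r \in P) && (c \in Q)).
case: (separated_or_shortest_path e P Q).
  case=> R1 [C1 [PR1 C1Q sep]].
  have /card_gt0P[p0 p0P] := ltnW P2; have /card_gt0P[q0 q0Q] := ltnW Q2.
  (* The factors come from [biclique_rank1], extended by zero: a nonzero entry outside [P x Q] is an
     edge of [e], and no such edge leaves the separated part. *)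
  have [] := @two_separation_of_blocks _ _ _ N R1 C1
     (fun r => if r \in P then N r q0 else 0)
     (fun c => if c \in Q then N p0 c / N p0 q0 else 0).
  - exact: leq_trans P2 (subset_leq_card PR1).
  - apply: leq_trans Q2 (subset_leq_card _).
    by rewrite disjoint_sym disjoints_subset in C1Q.
  - move=> r c rR cC; apply/eqP/negbNE/negP=> nz.
    have /sep : e r c by rewrite /e nz (disjointFr C1Q cC) andbF.
    by rewrite cC (negPf rR).
  - move=> r c rR cC; case: (boolP (e r c)) => [/sep|]; first by rewrite rR (negPf cC).
    rewrite negb_and !negbK => /orP[/eqP rc0|/andP[rP cQ]]; last first.
      by rewrite rP cQ; apply: biclique_rank1 bPQ _ _ _ _.
    rewrite rc0; case: ifP => [rP|]; last by rewrite mul0r.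
    case: ifP => [cQ|]; last by rewrite mulr0.
    by have := nzPQ _ _ rP cQ; rewrite rc0 eqxx.
  by move=> X; apply: conn.
case=> K [r [c [[r0P cKQ rc rc'] [ebound eP eQ rP cQ]]]].
(* No edge of [e] joins [P] directly to [Q]. This gives the submatrix order [K + 2] at least 3. *)
have K_gt0 : (0 < K)%N.
  case: (posnP K) => // K0; move: cKQ (rc 0%N); rewrite K0 => c0Q /(_ isT).
  by rewrite /e r0P c0Q andbF.
have c0Q : c 0%N \notin Q by apply/negP=> /(cQ _ (leq0n _)); lia.
have rKP : r K \notin P by apply/negP=> /(rP _ (leqnn _)); lia.
have [p' p'P p'c0] := maxQ _ c0Q.
have [q' q'Q rKq'] := maxP _ rKP.
have Nrc i : (i <= K)%N -> N (r i) (c i) != 0 by move=> /rc/andP[].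
have Nrc' i : (i < K)%N -> N (r i.+1) (c i) != 0 by move=> /rc'/andP[].
(* A nonzero entry off the path's band is no edge of [e], hence lies in [P x Q], which the path
   meets only at [(r 0, c K)]. *)
have N0 i j : (i <= K)%N -> (j <= K)%N -> ~~ (j <= i <= j.+1)%N ->
    N (r i) (c j) != 0 -> i = 0%N /\ j = K.
  move=> iK jK nij nz; have : ~~ e (r i) (c j).
    by apply: contra nij => /ebound; apply.
  by rewrite /e nz /= negbK => /andP[/(rP _ iK)-> /(cQ _ jK)->].
have Np' j : (j < K)%N -> N p' (c j) = 0.
  move=> jK; apply/eqP/negbNE/negP=> nz.
  have cjQ : c j \notin Q by apply/negP=> /(cQ _ (ltnW jK)); lia.
  have /(eP _ _ (ltnW jK) p'P) j0 : e p' (c j) by rewrite /e nz (negPf cjQ) andbF.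
  by rewrite j0 p'c0 eqxx in nz.
have Nq' i : (0 < i <= K)%N -> N (r i) q' = 0.
  case/andP=> i0 iK; apply/eqP/negbNE/negP=> nz.
  have riP : r i \notin P by apply/negP=> /(rP _ iK); lia.
  have /(eQ _ _ iK q'Q) iE : e (r i) q' by rewrite /e nz (negPf riP).
  by rewrite iE rKq' eqxx in nz.
have r_le i j : (i <= K)%N -> (j <= K)%N -> r i = r j -> (j <= i)%N.
  by move=> iK jK E; have := rc j jK; rewrite -E => /(ebound _ _ iK jK)/andP[].
have c_le i j : (i <= K)%N -> (j <= K)%N -> c i = c j -> (i <= j)%N.
  by move=> iK jK E; have := rc j jK; rewrite -E => /(ebound _ _ jK iK)/andP[].
have p'r i : (i <= K)%N -> p' <> r i.
  move=> iK E; have i0 : i = 0%N by apply: rP; rewrite -?E.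
  by have := Nrc 0%N (leq0n _); rewrite -i0 -E i0 p'c0 eqxx.
have q'c j : (j <= K)%N -> q' <> c j.
  move=> jK E; have jK' : j = K by apply: cQ; rewrite -?E.
  by have := Nrc K (leqnn _); rewrite -jK' -E jK' rKq' eqxx.
have [k EK] : exists k, K = k.+1 by case: (K) K_gt0 => // k; exists k.
subst K.
(* With index 0 for [p'] and [q'] and a shift by one along the path, the entries [N (r i) (c i)]
   fall on the diagonal and [N (r i.+1) (c i)] on the subdiagonal. *)
pose f (a : 'I_k.+3) := if val a is i.+1 then r i else p'.
pose g (a : 'I_k.+3) := if val a is j.+1 then c j else q'.
have fI : injective f.
  case=> [[|a] Ha] [[|b] Hb]; rewrite /f /= => E; apply/val_inj => //=.
  - by case: (p'r b).
  - by case: (p'r a).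
  by apply/eqP; rewrite eqSS eqn_leq (r_le _ _ _ _ (esym E)) ?(r_le _ _ _ _ (E)).
have gI : injective g.
  case=> [[|a] Ha] [[|b] Hb]; rewrite /g /= => E; apply/val_inj => //=.
  - by case: (q'c b).
  - by case: (q'c a).
  by apply/eqP; rewrite eqSS eqn_leq (c_le _ _ _ _ (E)) ?(c_le _ _ _ _ (esym E)).
have det_val i j : N (f i) (g j) != 0 ->
    unimodular_value (\det (zero_entry (mxsub f g N) i j)).
  by move=> nz; rewrite -mxsub_zero_entry //; apply: su (TU_entry tu nz) _ _ _ _ _.
have nzL0 : N (f ord0) (g ord_max) != 0 by apply: nzPQ.
have nzL1 : N (f (lift ord0 ord0)) (g ord_max) != 0 by apply: nzPQ.
apply: (@det_zero_entries_not_unimodular R k (mxsub f g N)); rewrite ?mxE //.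
- case=> [[|i] Hi]; rewrite mxE; [exact: nzPQ | exact: Nrc].
- case=> [[|i] Hi] [[|j] Hj] //= ij; rewrite mxE /f /g /= => nz.
    have jK : j = k.+1.
      apply/eqP; apply: contraNT nz => njK; apply/eqP/Np'.
      by rewrite ltn_neqAle njK.
    by split=> //; apply: val_inj; rewrite /= jK.
  have nij : ~~ (j <= i <= j.+1)%N by rewrite leqNgt (ij : (i < j)%N).
  have [-> jK] := N0 i j Hi Hj nij nz.
  by split=> //; apply: val_inj; rewrite /= jK.
- by case=> [[|[|i]] Hi] // _; rewrite mxE; apply: Nq'.
- case=> [[|i] Hi] [[|j] Hj] //= _ ij; rewrite mxE /f /g /=.
  have nij : ~~ (j <= i <= j.+1)%N.
    by rewrite negb_and -!ltnNge (ij : (j.+1 < i)%N) orbT.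
  apply/eqP/negbNE/negP=> nz; have [i0 _] := N0 i j Hi Hj nij nz.
  by rewrite i0 in ij.
- case=> [[|i] Hi] [[|j] Hj] //= _ [ij]; rewrite mxE.
  by rewrite /f /g /= ij; apply: Nrc'; rewrite -ij.
(* Rows [p'], [r 0] and columns [q'], [c K] all belong to the biclique. *)
- by apply: TU_minor2; rewrite ?nzPQ.
- exact: tu.
- exact: det_val.
- exact: det_val.
Qed.
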